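(* Let $r\ge 0$ be an integer, let $q$ be a complex number with $0<|q|<1$, let $a_1,\dots,a_{r+1}$ be non-zero complex numbers satisfying $a_i/a_j\notin\{\dots,q^{-2},q^{-1},1,q,q^2,\dots\}$ for $1\le i<j\le r+1$, let $b_1,\dots,b_{r+1}$ be non-zero complex numbers, and let $m_1,\dots,m_{r+1}$ be integers such that, whenever $m_j<0$, $a_i/b_j\notin\{1,q,\dots,q^{-m_j-1}\}$ for all $1\le i\le r+1$. Put $M:=\sum_{i=1}^{r+1}m_i$, $M_2:=\sum_{i=1}^{r+1}m_i(m_i+1)/2$, $$c_i:=(-1)^Mq^{-M_2}\frac{\prod_{j=1}^{r+1}b_j^{m_j}(qa_i/b_j;q)_{m_j}}{\prod_{1\le j\le r+1,\ j\ne i}(a_i-a_j)}\qquad(1\le i\le r+1),$$ and $$G(z):=\sum_{i=1}^{r+1}c_i\times{}_{r+1}\phi_r\Big(\begin{matrix}q^{1+m_1}a_i/b_1,\dots,q^{1+m_{r+1}}a_i/b_{r+1}\\ qa_i/a_1,\dots,*,\dots,qa_i/a_{r+1}\end{matrix}\Big|\,wz\Big)\times{}_{r+1}\phi_r\Big(\begin{matrix}b_1/a_i,\dots,b_{r+1}/a_i\\ qa_1/a_i,\dots,*,\dots,qa_{r+1}/a_i\end{matrix}\Big|\,z\Big),$$ where $w:=q^{-r}\prod_{i=1}^{r+1}b_i/a_i$ and the asterisk means that the term $qa_i/a_i$ is omitted (so each lower parameter list has $r$ entries, indexed by $j\ne i$). Assume first that $m_i\ge 0$ for all $1\le i\le r+1$.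 Then: (i) If $M<r$, then $G(z)\equiv 0$. (ii) If $M=r$, then $G(z)\equiv 1/(1-z)$. (iii) If $M=r+1$, then $$G(z)\equiv\frac{1}{1-q}\left[\frac{C}{1-z}-\frac{q\alpha-\beta}{1-qz}\right],$$ where $\alpha=\sum_{i=1}^{r+1}a_i$, $\beta=\sum_{i=1}^{r+1}b_i$ and $C=\alpha-\sum_{i=1}^{r+1}b_iq^{-m_i}$. In the case when some of the $m_i$ are negative, the results in (i)-(iii) (with the same hypotheses on $M$ and the same right-hand sides) hold modulo $\mathcal{P}_{-\hat m}$, where $\hat m=\min_{1\le i\le r+1}m_i$.
   Context: For $|q|<1$ let $(x;q)_\infty:=\prod_{j\ge 0}(1-xq^j)$. The $q$-Pochhammer symbol is $(a;q)_k:=(a;q)_\infty/(aq^k;q)_\infty$ for $a\in\mathbb{C}$, $k\in\mathbb{Z}$, understood as $(a;q)_k=\prod_{s=0}^{k-1}(1-aq^s)$ for $k\ge 0$ and $(a;q)_{-n}=1/\prod_{s=1}^{n}(1-aq^{-s})$ for $n\ge 1$. The basic hypergeometric function is $${}_{r+1}\phi_r\Big(\begin{matrix}b_1,b_2,\dots,b_{r+1}\\ a_1,a_2,\dots,a_r\end{matrix}\Big|\,z\Big):=\sum_{k\ge 0}\frac{(b_1;q)_k(b_2;q)_k\cdots(b_{r+1};q)_k}{(a_1;q)_k(a_2;q)_k\cdots(a_r;q)_k}\cdot\frac{z^k}{(q;q)_k},$$ which converges when $|q|<1$ and $|z|<1$. Empty products equal $1$ and empty sums equal $0$. For functions represented by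 power series in $z$, $F(z)\equiv G(z)$ means that $F(z)=G(z)$ for all $z$ in some neighbourhood of zero. $\mathcal{P}_n$ denotes the set of polynomials in $z$ of degree at most $n$, and $F(z)\equiv G(z)$ modulo $\mathcal{P}_n$ means that $F(z)-G(z)\in\mathcal{P}_n$ (as functions in a neighbourhood of zero). *)

(* Defs.v *)
From mathcomp Require Import all_boot all_order all_algebra.
From mathcomp Require Import all_classical all_reals all_analysis.
From mathcomp Require Import complex.
Set Implicit Arguments.
Unset Strict Implicit.
Unset Printing Implicit Defensive.
Import Order.TTheory GRing.Theory Num.Theory.
Import numFieldNormedType.Exports.
Local Open Scope classical_set_scope.
Local Open Scope ring_scope.

(* R[i] carries no topology of its own; typed as a numClosedFieldType it gets
   the one induced by the modulus. *)
Definition complexField (R : realType) : numClosedFieldType := R[i].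

(* The finite-product form of (a; q)_oo / (a q^k; q)_oo; Negz n is -(n + 1). *)
Definition qpoch (K : fieldType) (q a : K) (k : int) : K :=
  match k with
  | Posz n => \prod_(0 <= s < n) (1 - a * q ^+ s)
  | Negz n => (\prod_(1 <= s < n.+2) (1 - a * q ^- s))^-1
  end.

(* {}_{r+1} phi_r (b_1, ..., b_{r+1}; a_1, ..., a_r | z) in base q. *)
Definition qhyp (K : numClosedFieldType) (q : K) (r : nat)
    (b : 'I_r.+1 -> K) (a : 'I_r -> K) (z : K) : K :=
  limn (series (fun k : nat =>
    (\prod_(j < r.+1) qpoch q (b j) k) / (\prod_(j < r) qpoch q (a j) k)
      * (z ^+ k / qpoch q q k))).

Definition eq_near0 (K : numClosedFieldType) (F G : K -> K) : Prop :=
  \forall z \near (0 : K), F z = G z.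

(* A polynomial p has degree at most n iff size p <= n + 1. *)
Definition eq_near0_mod (K : numClosedFieldType) (n : nat) (F G : K -> K)
    : Prop :=
  exists2 p : {poly K},
    (size p <= n.+1)%N & eq_near0 (fun z => F z - G z) (fun z => p.[z]).

Definition mtotal (r : nat) (m : 'I_r.+1 -> int) : int := \sum_(i < r.+1) m i.

(* The integer division is exact, m i * (m i + 1) being even. *)
Definition mtotal2 (r : nat) (m : 'I_r.+1 -> int) : int :=
  \sum_(i < r.+1) ((m i * (m i + 1)) %/ 2)%Z.

Definition mleast (r : nat) (m : 'I_r.+1 -> int) : int :=
  \big[Order.min/m ord0]_(i < r.+1) m i.

Definition ccoef (K : fieldType) (q : K) (r : nat) (a b : 'I_r.+1 -> K)
    (m : 'I_r.+1 -> int) (i : 'I_r.+1) : K :=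
  (-1) ^ mtotal m * q ^ (- mtotal2 m) *
  ((\prod_(j < r.+1) (b j ^ m j * qpoch q (q * a i / b j) (m j)))
     / \prod_(j < r.+1 | j != i) (a i - a j)).

Definition wparam (K : fieldType) (q : K) (r : nat) (a b : 'I_r.+1 -> K) : K :=
  q ^- r * \prod_(i < r.+1) (b i / a i).

(* lift i : 'I_r -> 'I_r.+1 enumerates the indices different from i. *)
Definition Gfun (K : numClosedFieldType) (q : K) (r : nat)
    (a b : 'I_r.+1 -> K) (m : 'I_r.+1 -> int) (z : K) : K :=
  \sum_(i < r.+1) ccoef q a b m i
    * qhyp q (fun j : 'I_r.+1 => q ^ (1 + m j) * a i / b j)
             (fun j : 'I_r => q * a i / a (lift i j))
             (wparam q a b * z)
    * qhyp q (fun j : 'I_r.+1 => b j / a i)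
             (fun j : 'I_r => q * a (lift i j) / a i)
             z.

Definition rhs_iii (K : fieldType) (q : K) (r : nat)
    (a b : 'I_r.+1 -> K) (m : 'I_r.+1 -> int) (z : K) : K :=
  let alpha := \sum_(i < r.+1) a i in
  let beta := \sum_(i < r.+1) b i in
  let C := alpha - \sum_(i < r.+1) b i * q ^ (- m i) in
  (1 - q)^-1 * (C / (1 - z) - (q * alpha - beta) / (1 - q * z)).

(* Main.v *)
Require Import Defs.
From mathcomp Require Import all_boot all_order all_algebra.
From mathcomp Require Import all_classical all_reals all_analysis.
From mathcomp Require Import complex.
From mathcomp Require Import ring zify.
Set Implicit Arguments.
Unset Strict Implicit.
Unset Printing Implicit Defensive.
Import Order.TTheory GRing.Theory Num.Theory.
Import numFieldNormedType.Exports.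
Local Open Scope ring_scope.

(** The coefficient of z^n in G is a sum of residues.  Multiplying out the two
    series, it is a double sum over the parameters a_i and over 0 <= k <= n;
    put y = a_i q^k.  The factors (q a_i/b_j)_(m_j), (q^(1+m_j) a_i/b_j)_k and
    (b_j/a_i)_(n-k) are pieces of one product, and together they
    amount to the product of the y - b_j q^t over -m_j <= t < n.  The lower
    parameters similarly amount to the product of the y - a_j q^l over the
    pairs (j, l) other than (i, k), with 0 <= l <= n.  All the remaining powers
    of q, of a_i and of b_j are cancelled by c_i and by w^k; this is
    [residue_term].  So the term is the residue at y of N/D, where

      N = prod_j prod_(-m_j <= t < n) (X - b_j q^t),
      D = prod_j prod_(0 <= l <= n) (X - a_j q^l),

    and D has simple roots because no a_i/a_j is a power of q and q is not a
    root of unity.  N is a polynomial as soon as n + m_j >= 0 for all j.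

    The sum of the residues is read off at infinity.  Since
    deg N - deg D = M - r - 1, it is 0 when M < r, it is 1 when M = r, and it
    is the sum of the roots of D minus the sum of the roots of N when
    M = r + 1 ([sum_lagrange_roots]); these two sums are geometric, whence
    [Gcoef_value].  When M = r + 1 the outcome is affine in q^n, so that it
    contributes two geometric series, with singularities at 1 and at 1/q.

    When some m_j is negative, the coefficients of index n < - min m_j escape
    this computation; they make up the polynomial modulo which the equalities
    hold.

    To pass from coefficients to functions near 0, note that the coefficients
    of both hypergeometric series grow at most geometrically: the factors
    1 - x q^s tend to 1 and, in the denominators, never vanish.  Hence both
    series converge absolutely near 0, and [power_sumM] multiplies them. *)

(** * Sums of residues of rational functions *)

(** Lagrange interpolation at the points [y i] reproduces [p], and each basis
    polynomial has leading coefficient 1; compare the coefficients of degree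
    [#|I|.-1]. *)
Lemma sum_lagrange (K : fieldType) (I : finType) (y : I -> K) (p : {poly K}) :
    injective y -> (size p <= #|I|)%N ->
  \sum_i p.[y i] / \prod_(j | j != i) (y i - y j) = p`_(#|I|.-1).
Proof.
move=> injy szp.
pose l i := \prod_(j | j != i) ('X - (y j)%:P) : {poly K}.
pose d i := \prod_(j | j != i) (y i - y j).
have d0 i : d i != 0.
  apply/prodf_neq0 => j ji; rewrite subr_eq0.
  by apply: contraNneq ji => /injy ->.
have szl i : size (l i) = #|I|.
  have I0 : (0 < #|I|)%N by apply/card_gt0P; exists i.
  rewrite /l -big_filter size_prod_XsubC.
  by have [e _ _ [_ ->]] := big_enumP; rewrite cardC1 prednK.
have li i k : (l i).[y k] = if k == i then d i else 0.
  rewrite /l horner_prod; under eq_bigr do rewrite hornerXsubC.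
  case: eqVneq => [->//|ki].
  by rewrite (bigD1 k)//= subrr mul0r.
have defp : p = \sum_i (p.[y i] / d i) *: l i.
  apply/eqP; rewrite -subr_eq0; apply/eqP.
  apply: (@roots_geq_poly_eq0 _ _ (map y (enum I))).
  - apply/allP => _ /mapP[k _ ->]; rewrite rootE hornerD hornerN horner_sum.
    rewrite (bigD1 k)//= hornerZ li eqxx divfK//.
    rewrite big1 ?addr0 ?subrr// => i ik.
    by rewrite hornerZ li eq_sym (negPf ik) mulr0.
  - by rewrite map_inj_uniq// enum_uniq.
  - rewrite size_map -cardE.
    apply: (leq_trans (size_polyD _ _)); rewrite size_polyN geq_max szp.
    apply: (leq_trans (size_sum _ _ _)); apply/bigmax_leqP => i _.
    by rewrite (leq_trans (size_scale_leq _ _))// szl.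
rewrite [in RHS]defp coef_sum; apply: eq_bigr => i _; rewrite coefZ.
have -> : (l i)`_(#|I|.-1) = 1.
  have := monic_prod_XsubC (index_enum I) (fun j => j != i) y.
  by rewrite monicE lead_coefE -/(l i) szl => /eqP.
by rewrite mulr1.
Qed.

(** The sum of the residues of N/D for monic N and D given by their roots [s]
    and [y].  In the borderline case of equal degrees, N is replaced by N - D,
    which has the same values at the roots of D and a smaller degree. *)
Lemma sum_lagrange_roots (K : fieldType) (I : finType) (y : I -> K)
    (s : seq K) : injective y -> (size s <= #|I|)%N -> (0 < #|I|)%N ->
  \sum_i (\prod_(c <- s) ('X - c%:P)).[y i] / \prod_(j | j != i) (y i - y j)
  = if size s == #|I| then \sum_i y i - \sum_(c <- s) c
    else ((size s).+1 == #|I|)%:R.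
Proof.
move=> injy szs I0; set p := \prod_(c <- s) _.
have szp : size p = (size s).+1 by rewrite size_prod_XsubC.
have mp : p \is monic by apply: monic_prod_XsubC.
case: eqP => [sI|/eqP sI]; last first.
  rewrite sum_lagrange ?szp ?ltn_neqAle ?sI//.
  case: eqP => [<-|/eqP sI1].
    by move: mp; rewrite monicE lead_coefE szp => /eqP.
  by rewrite nth_default// szp; lia.
pose t := map y (enum I); pose D := \prod_(c <- t) ('X - c%:P).
have szt : size t = #|I| by rewrite size_map cardE.
have D0 i : D.[y i] = 0.
  rewrite /D big_map horner_prod big_enum (bigD1 i)//= hornerXsubC subrr.
  by rewrite mul0r.
have -> : \sum_i p.[y i] / \prod_(j | j != i) (y i - y j) =
          \sum_i (p - D).[y i] / \prod_(j | j != i) (y i - y j).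
  by apply: eq_bigr => i _; rewrite hornerD hornerN D0 subr0.
rewrite sum_lagrange//; last first.
  have mD : D \is monic by apply: monic_prod_XsubC.
  have szD : size D = #|I|.+1 by rewrite size_prod_XsubC szt.
  apply/leq_sizeP => k; rewrite leq_eqVlt coefB => /predU1P[<-|kI].
    move: mp mD; rewrite !monicE !lead_coefE szp szD -sI/= => /eqP -> /eqP ->.
    by rewrite subrr.
  by rewrite !nth_default ?subrr// ?szp ?szD ?sI.
rewrite coefB -{1}sI coefPn_prod_XsubC -?lt0n ?sI//.
rewrite -{1}szt coefPn_prod_XsubC -?lt0n ?szt// big_map big_enum/=.
by rewrite opprK addrC.
Qed.

(** * q-Pochhammer symbols *)

(** The exponents m(m+1)/2, in the form in which they occur in [mtotal2]. *)
Definition triangular (x : int) : int := ((x * (x + 1)) %/ 2)%Z.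

Lemma triangularE x : triangular x * 2 = x * (x + 1).
Proof.
rewrite /triangular divzK//.
have [y [->|->]] : exists y : int, x = y * 2 \/ x = y * 2 + 1.
  by exists (x %/ 2)%Z; lia.
- by apply/dvdzP; exists (y * (y * 2 + 1)); ring.
- by apply/dvdzP; exists ((y * 2 + 1) * (y + 1)); ring.
Qed.

Lemma qpochSr (K : fieldType) (q x : K) (n : nat) :
  qpoch q x n.+1 = qpoch q x n * (1 - x * q ^+ n).
Proof. by rewrite /= big_nat_recr. Qed.

Lemma qpochD (K : fieldType) (q x : K) (n k : nat) :
  qpoch q x (n + k)%N = qpoch q x n * qpoch q (x * q ^+ n) k.
Proof.
elim: k => [|k IH]; first by rewrite addn0 /= [X in _ * X]big_geq// mulr1.
by rewrite addnS !qpochSr IH exprD !mulrA.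
Qed.

(** Brings the symbols of negative index to natural indices. *)
Lemma qpoch_neg (K : fieldType) (q x : K) (p : nat) : q != 0 ->
  qpoch q (q * x) (- p%:Z) = (qpoch q (x * q ^ (1 - p%:Z)) p)^-1.
Proof.
move=> q0; case: p => [|p]; first by rewrite /= !big_geq ?invr1.
rewrite -NegzE /qpoch; congr (_^-1).
rewrite big_add1 /= big_nat_rev/= big_nat_cond [RHS]big_nat_cond.
apply: eq_bigr => s /andP[/andP[_ sp] _].
congr (1 - _).
rewrite exprnN [q ^+ s]exprnP [q * x]mulrC -!mulrA -{1}[q]expr1z -!expfzDr//.
by congr (_ * _ ^ _); lia.
Qed.

(** Take - q^s/x out of each factor 1 - q^s/x, then reverse their order. *)
Lemma qpochV (K : fieldType) (q x : K) (n : nat) : q != 0 -> x != 0 ->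
  qpoch q x^-1 n =
  (- x^-1) ^+ n * q ^ triangular (n%:Z - 1) * qpoch q (x * q ^ (1 - n%:Z)) n.
Proof.
move=> q0 x0; elim: n => [|n IH].
  have -> : triangular (0%:Z - 1) = 0 by [].
  by rewrite expr0z expr0 !mul1r /= !big_geq.
have -> : qpoch q (x * q ^ (1 - n.+1%:Z)) n.+1 =
    (1 - x * q ^ (- n%:Z)) * qpoch q (x * q ^ (1 - n%:Z)) n.
  rewrite -add1n qpochD; congr (_ * _).
    by rewrite /= big_nat1 expr0 mulr1; congr (1 - _ * _ ^ _); lia.
  by rewrite -mulrA exprnP -expfzDr//; congr (qpoch q (x * q ^ _) _); lia.
rewrite qpochSr IH exprSr.
have -> : triangular (n.+1%:Z - 1) = triangular (n%:Z - 1) + n%:Z.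
  have := triangularE (n.+1%:Z - 1); have := triangularE (n%:Z - 1); nia.
have -> : 1 - x^-1 * q ^+ n = - x^-1 * q ^ n%:Z * (1 - x * q ^ (- n%:Z)).
  have qq : q ^ n%:Z * q ^ (- n%:Z) = 1 by rewrite -expfzDr// subrr.
  rewrite mulrBr mulr1 mulrACA [- x^-1 * x]mulNr mulVf// qq exprnP; ring.
by rewrite expfzDr//; ring.
Qed.

Lemma qpoch_neq0 (K : fieldType) (q x : K) (n : nat) :
  (forall s, (s < n)%N -> x * q ^+ s != 1) -> qpoch q x n != 0.
Proof.
move=> h; rewrite /= big_mkord; apply/prodf_neq0 => s _.
by rewrite subr_eq0 eq_sym h.
Qed.

(** The three symbols are pieces of a single one.  Put Y = x q^(1+k-n).  For
    m >= 0 they are consecutive.  For m = - p < 0 the second one is the inverse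
    of (X)_p and the third one is (X)_k, with X = x q^(1-p); then
    (Y)_(n-k) (X)_k = (Y)_(n-p) (X)_p, both sides being regroupings of the same
    factors because Y q^(n-p) = X q^k and Y q^(n-k) = X q^p. *)
Lemma qpoch_overlap (K : fieldType) (q x : K) (n k : nat) (m : int) :
    q != 0 -> (k <= n)%N -> 0 <= n%:Z + m ->
    (m < 0 -> forall s : nat, s%:Z <= - m - 1 -> x != q ^+ s) ->
  qpoch q (x * q ^ (1 + k%:Z - n%:Z)) (n - k)%N
    * (qpoch q (q * x) m * qpoch q (q ^ (1 + m) * x) k)
  = qpoch q (x * q ^ (1 + k%:Z - n%:Z)) (absz (n%:Z + m)%R).
Proof.
move=> q0 kn; set Y := x * _.
have Yq s : Y * q ^+ s = x * q ^ (1 + k%:Z - n%:Z + s%:Z).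
  by rewrite /Y exprnP -mulrA -expfzDr.
case: (lerP 0 m) => [|m0]; first case: m => // p _ _ _.
  have -> : (absz (n%:Z + p%:Z)%R) = (n - k + (p + k))%N by lia.
  rewrite !qpochD; congr (_ * (_ * _)); congr (qpoch _ _ _).
    rewrite Yq mulrC -{1}[q]expr1z; congr (_ * _ ^ _); lia.
  rewrite Yq mulrC -mulrA exprnP -expfzDr//; congr (_ * _ ^ _); lia.
have [p mp] : exists p : nat, m = - p%:Z by exists (absz m); lia.
move: m0; rewrite mp.
move=> m0' pn xq; rewrite qpoch_neg//.
set X := x * _; have -> : q ^ (1 - p%:Z) * x = X by rewrite mulrC.
have X0 : qpoch q X p != 0.
  apply: qpoch_neq0 => s sp; rewrite /X exprnP -mulrA -expfzDr//.
  apply/eqP => xq1; have /negP := xq isT (p - s.+1)%N ltac:(lia); apply.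
  apply/eqP; rewrite -[x]mulr1 -(expr0z q) exprnP.
  have -> : 0 = (1 - p%:Z + s%:Z) + (p - s.+1)%N%:Z by lia.
  by rewrite expfzDr// mulrA xq1 mul1r.
apply: (mulIf X0); rewrite [_^-1 * _]mulrC mulrA divfK//.
case: (leqP k p) => [kp|/ltnW pk].
  have -> : (n - k)%N = (absz (n%:Z - p%:Z)%R + (p - k))%N by lia.
  rewrite qpochD -[in qpoch q X p](subnKC kp) qpochD -[LHS]mulrA; congr (_ * _).
  rewrite mulrC; congr (_ * qpoch q _ _).
  by rewrite Yq /X exprnP -mulrA -expfzDr//; congr (_ * _ ^ _); lia.
have -> : absz (n%:Z - p%:Z) = ((n - k) + (k - p))%N by lia.
rewrite qpochD -[in qpoch q X k](subnKC pk) qpochD -[RHS]mulrA; congr (_ * _).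
rewrite mulrC; congr (qpoch q _ _ * _).
by rewrite Yq /X exprnP -mulrA -expfzDr//; congr (_ * _ ^ _); lia.
Qed.

(** * Factors of the numerator and of the denominator *)

Arguments qpoch : simpl never.

Lemma prod_subr_qpoch (K : fieldType) (q b y : K) (e : int) (P : nat) :
    q != 0 -> b != 0 ->
  \prod_(s < P) (y - b * q ^ (e - s%:Z)) =
  (- b) ^+ P * q ^ (P%:Z * e - triangular (P%:Z - 1))
  * qpoch q (y / b * q ^ (- e)) P.
Proof.
move=> q0 b0; elim: P => [|P IH].
  rewrite big_ord0; have -> : 0%:Z * e - triangular (0%:Z - 1) = 0.
    by rewrite mul0r.
  by rewrite expr0z expr0 !mul1r /qpoch big_geq.
rewrite big_ord_recr/= {}IH qpochSr exprSr.
have -> : P.+1%:Z * e - triangular (P.+1%:Z - 1) =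
    P%:Z * e - triangular (P%:Z - 1) + (e - P%:Z).
  have := triangularE (P.+1%:Z - 1); have := triangularE (P%:Z - 1); nia.
have -> : y - b * q ^ (e - P%:Z) =
    - b * q ^ (e - P%:Z) * (1 - y / b * q ^ (- e) * q ^+ P).
  have qq : q ^ (e - P%:Z) * (q ^ (- e) * q ^ P%:Z) = 1.
    by rewrite -!expfzDr// [X in _ ^ X](_ : _ = 0)//; lia.
  rewrite mulrBr mulr1 exprnP -[y / b * _ * _]mulrA mulrACA qq mulr1 mulNr.
  by field.
by rewrite [q ^ (_ + (e - P%:Z))]expfzDr//; ring.
Qed.

(** By [qpoch_overlap] the symbols that involve b_j merge into one, which
    [prod_subr_qpoch] turns into the factors of N at the pole y = a q^k.  Of the
    extra factors, (-1)^m q^(m(m+1)/2) is cancelled by the prefactor of c_i,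
    b^(-k) by w^k, and the rest by the extra factors of [denom_factor]. *)
Lemma numer_factor (K : fieldType) (q a b : K) (n k : nat) (m : int) :
    q != 0 -> a != 0 -> b != 0 -> (k <= n)%N -> 0 <= n%:Z + m ->
    (m < 0 -> forall s : nat, s%:Z <= - m - 1 -> a / b != q ^+ s) ->
  b ^ m * qpoch q (q * a / b) m * qpoch q (q ^ (1 + m) * a / b) k
    * qpoch q (b / a) (n - k)%N
  = (-1) ^ m * q ^ triangular m
    * ((-1) ^+ k * a ^- (n - k)%N * q ^ (triangular k - n%:Z * k%:Z) * b ^- k)
    * \prod_(s < absz (n%:Z + m)) (a * q ^+ k - b * q ^ (n%:Z - 1 - s%:Z)).
Proof.
move=> q0 a0 b0 kn nm0 hm.
have x0 : a / b != 0 by rewrite mulf_neq0 ?invr_eq0.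
have := qpoch_overlap q0 kn nm0 hm.
rewrite prod_subr_qpoch// -[b / a]invf_div qpochV//.
have -> : a * q ^+ k / b * q ^ (- (n%:Z - 1)) = a / b * q ^ (1 + k%:Z - n%:Z).
  have -> : 1 + k%:Z - n%:Z = k%:Z + - (n%:Z - 1) by lia.
  by rewrite expfzDr// -exprnP; ring.
have -> : 1 - (n - k)%N%:Z = 1 + k%:Z - n%:Z by lia.
rewrite -![_ * a / b]mulrA => ov.
transitivity (b ^ m * ((- (a / b)^-1) ^+ (n - k)
    * q ^ triangular ((n - k)%N%:Z - 1))
    * qpoch q (a / b * q ^ (1 + k%:Z - n%:Z)) (absz (n%:Z + m))).
  by rewrite -ov; ring.
rewrite [RHS]mulrA; congr (_ * _).
set P := absz _; have PE : P%:Z = n%:Z + m by rewrite /P; lia.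
have -> : triangular ((n - k)%N%:Z - 1) =
    triangular m + (triangular k - n%:Z * k%:Z)
    + (P%:Z * (n%:Z - 1) - triangular (P%:Z - 1)).
  have := triangularE ((n - k)%N%:Z - 1); have := triangularE (P%:Z - 1).
  have := triangularE m; have := triangularE k.
  have -> : (n - k)%N%:Z = n%:Z - k%:Z by lia.
  rewrite PE; nia.
rewrite [q ^ (_ + _ + (_ - _))]expfzDr// [q ^ (triangular m + _)]expfzDr//.
rewrite invf_div -[- (b / a)]mulNr expr_div_n.
rewrite [(- b) ^+ (n - k)]exprNn [(- b) ^+ P]exprNn.
have sgn : (-1) ^+ (n - k) = (-1) ^ m * (-1) ^+ k * (-1) ^+ P :> K.
  rewrite !exprnP -!expfzDr ?oppr_eq0 ?oner_eq0// PE.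
  have -> : m + k%:Z + (n%:Z + m) = (n - k)%N%:Z + (m + k%:Z) * 2 by lia.
  rewrite expfzDr ?oppr_eq0 ?oner_eq0// [_ * 2]mulrC -exprz_exp.
  by rewrite -[_ ^ 2]exprnP sqrrN expr1n exp1rz mulr1.
have bb : b ^ m * b ^+ (n - k) = b ^- k * b ^+ P.
  by rewrite exprnN !exprnP -!expfzDr//; congr (_ ^ _); lia.
rewrite sgn; transitivity (b ^ m * b ^+ (n - k) * ((-1) ^ m * (-1) ^+ k
    * (-1) ^+ P * a ^- (n - k)
    * (q ^ triangular m * q ^ (triangular k - n%:Z * k%:Z)
    * q ^ (P%:Z * (n%:Z - 1) - triangular (P%:Z - 1))))); first by ring.
by rewrite bb; ring.
Qed.

(** The factors with l < k give the first symbol, those with l > k the second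
    one.  This serves for c = a_j with j != i, and also for c = a, which accounts
    for the symbols (q; q)_k and (q; q)_(n-k). *)
Lemma denom_factor (K : fieldType) (q a c : K) (n : nat) (k : 'I_n.+1) :
    q != 0 -> a != 0 -> c != 0 ->
  \prod_(l < n.+1 | l != k) (a * q ^+ k - c * q ^+ l) =
  (-1) ^+ k * a ^+ (n - k)
  * q ^ (triangular (k%:Z - 1) + k%:Z * (n - k)%N%:Z) * c ^+ k
  * (qpoch q (q * a / c) k * qpoch q (q * c / a) (n - k)%N).
Proof.
move=> q0 a0 c0.
pose F l := a * q ^+ k - c * q ^+ l.
have -> : \prod_(l < n.+1 | l != k) F l =
    \prod_(0 <= l < k) F l * \prod_(k.+1 <= l < n.+1) F l.
  transitivity (\prod_(0 <= l < n.+1 | l != k) F l); first by rewrite big_mkord.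
  rewrite (big_cat_nat (n := k))//=; last by rewrite ltnW.
  congr (_ * _).
    rewrite [LHS]big_nat_cond [RHS]big_nat_cond; apply: eq_bigl => l.
    by rewrite andbT; case: ltngtP; rewrite ?andbF.
  rewrite big_ltn_cond// eqxx.
  rewrite [LHS]big_nat_cond [RHS]big_nat_cond; apply: eq_bigl => l.
  lia.
have -> : \prod_(0 <= l < k) F l =
    (- c) ^+ k * q ^ triangular (k%:Z - 1) * qpoch q (q * a / c) k.
  have -> : \prod_(0 <= l < k) F l =
      \prod_(s < k) (a * q ^+ k - c * q ^ (k%:Z - 1 - s%:Z)).
    rewrite big_nat_rev big_mkord; apply: eq_bigr => s _ /=.
    rewrite /F [q ^+ (_ - _)]exprnP; congr (_ - _ * _ ^ _).
    by have := ltn_ord s; lia.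
  rewrite prod_subr_qpoch//; congr (_ * q ^ _ * qpoch q _ _).
    by have := triangularE (k%:Z - 1); nia.
  have -> : q ^+ k = q ^ (k%:Z - 1) * q by rewrite -{3}[q]expr1z -expfzDr// subrK.
  have qq : q ^ (k%:Z - 1) * q ^ (- (k%:Z - 1)) = 1 by rewrite -expfzDr// subrr.
  rewrite [RHS]mulrC -[RHS]mulr1 -qq; ring.
have -> : \prod_(k.+1 <= l < n.+1) F l =
    (a * q ^+ k) ^+ (n - k) * qpoch q (q * c / a) (n - k)%N.
  rewrite -{1}[k.+1]add0n big_addn subSS /qpoch.
  rewrite !big_mkord -[X in _ ^+ X]card_ord -prodr_const -big_split/=.
  by apply: eq_bigr => s _; rewrite /F addnS exprS exprD ; field.
have -> : q ^ (triangular (k%:Z - 1) + k%:Z * (n - k)%N%:Z) =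
    q ^ triangular (k%:Z - 1) * (q ^+ k) ^+ (n - k).
  by rewrite expfzDr// exprnP exprnP exprz_exp.
by rewrite exprMn [(- c) ^+ k]exprNn; ring.
Qed.

(** * The terms of a coefficient as residues *)

Definition qhyp_coef (K : fieldType) (q : K) (r : nat) (b : 'I_r.+1 -> K)
    (a : 'I_r -> K) (k : nat) : K :=
  (\prod_(j < r.+1) qpoch q (b j) k) / (\prod_(j < r) qpoch q (a j) k)
    / qpoch q q k.

Definition Gcoef (K : fieldType) (q : K) (r : nat) (a b : 'I_r.+1 -> K)
    (m : 'I_r.+1 -> int) (n : nat) : K :=
  \sum_(i < r.+1) ccoef q a b m i *
    \sum_(k < n.+1)
      (wparam q a b ^+ k
         * qhyp_coef q (fun j => q ^ (1 + m j) * a i / b j)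
                       (fun j => q * a i / a (lift i j)) k)
      * qhyp_coef q (fun j => b j / a i)
                    (fun j => q * a (lift i j) / a i) (n - k)%N.

(** The roots b_j q^t of N, -m_j <= t < n, by decreasing t. *)
Definition numer_roots (K : fieldType) (q : K) (r : nat) (b : 'I_r.+1 -> K)
    (m : 'I_r.+1 -> int) (n : nat) : seq K :=
  [seq b j * q ^ (n%:Z - 1 - s%:Z)
     | j <- enum 'I_r.+1, s <- iota 0 (absz (n%:Z + m j))].

(** The derivative of D at the pole of index (i, k): in each column j != i, the
    factor of row k, which yields a_i - a_j, is set apart so that all the
    columns have the shape of [denom_factor]. *)
Lemma prod_punctured (K : comRingType) (n r : nat)
    (f : 'I_r.+1 -> 'I_n.+1 -> K) i k :
  \prod_(p : 'I_r.+1 * 'I_n.+1 | p != (i, k)) f p.1 p.2 =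
  (\prod_(j < r.+1 | j != i) f j k)
    * \prod_(j < r.+1) \prod_(l < n.+1 | l != k) f j l.
Proof.
rewrite [X in _ = _ * X](bigD1 i)//= mulrCA -big_split/=.
have fk j : f j k * \prod_(l < n.+1 | l != k) f j l = \prod_(l < n.+1) f j l.
  by rewrite [RHS](bigD1 k).
under [X in _ * X]eq_bigr do rewrite fk.
rewrite (eq_bigr (fun p => f p.1 p.2))//.
rewrite (eq_bigl (fun p => true && ((p.1, p.2) != (i, k)))); last by case.
rewrite -(pair_big_dep xpredT (fun j l => (j, l) != (i, k)) f).
rewrite (bigD1 i)//=; congr (_ * _).
  by apply: eq_bigl => l; rewrite xpair_eqE eqxx.
apply: eq_bigr => j ji; apply: eq_bigl => l.
by rewrite xpair_eqE (negPf ji).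
Qed.

Lemma prod_lift (K : comRingType) (r : nat) (F : 'I_r.+1 -> K)
    (i : 'I_r.+1) :
  (\prod_(j < r) F (lift i j)) * F i = \prod_j F j.
Proof. by rewrite (bigD1_ord i)//= mulrC. Qed.

(** The factor (q; q)_k in the denominator stands for the omitted lower
    parameter q a_i/a_i. *)
Lemma qhyp_coef_lift (K : fieldType) (q : K) (r : nat) (b : 'I_r.+1 -> K)
    (d : 'I_r.+1 -> K) (i : 'I_r.+1) (k : nat) : d i = q ->
  qhyp_coef q b (fun j => d (lift i j)) k =
  (\prod_j qpoch q (b j) k) / \prod_j qpoch q (d j) k.
Proof.
move=> di; rewrite /qhyp_coef.
by rewrite -(prod_lift (fun j => qpoch q (d j) k) i) di invfM mulrA.
Qed.

Lemma prod_exprz (K : fieldType) (x : K) (I : finType) (f : I -> int) :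
  x != 0 -> \prod_i x ^ f i = x ^ (\sum_i f i).
Proof.
by move=> x0; elim/big_rec2: _ => [|i y z _ ->]; rewrite ?expfzDr.
Qed.

Lemma residue_term (K : fieldType) (q : K) (r : nat) (a b : 'I_r.+1 -> K)
    (m : 'I_r.+1 -> int) (n : nat) (i : 'I_r.+1) (k : 'I_n.+1) :
    q != 0 -> (forall i, a i != 0) -> (forall i, b i != 0) ->
    injective (fun p : 'I_r.+1 * 'I_n.+1 => a p.1 * q ^+ p.2) ->
    (forall j, 0 <= n%:Z + m j) ->
    (forall j, m j < 0 -> forall s : nat, s%:Z <= - m j - 1 ->
       a i / b j != q ^+ s) ->
  ccoef q a b m i *
      ((wparam q a b ^+ k
         * qhyp_coef q (fun j => q ^ (1 + m j) * a i / b j)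
                       (fun j => q * a i / a (lift i j)) k)
      * qhyp_coef q (fun j => b j / a i)
                    (fun j => q * a (lift i j) / a i) (n - k)%N) =
  (\prod_(c <- numer_roots q b m n) ('X - c%:P)).[a i * q ^+ k]
    / \prod_(p : 'I_r.+1 * 'I_n.+1 | p != (i, k))
        (a i * q ^+ k - a p.1 * q ^+ p.2).
Proof.
move=> q0 a0 b0 inj nm hm.
have kn : (k <= n)%N by rewrite -ltnS.
rewrite (qhyp_coef_lift _ _ (d := fun j => q * a i / a j)) ?mulfK//.
rewrite (qhyp_coef_lift _ _ (d := fun j => q * a j / a i)) ?mulfK//.
have := prodf_neq0 (fun p => p != (i, k))
  (fun p : 'I_r.+1 * 'I_n.+1 => a i * q ^+ k - a p.1 * q ^+ p.2).
set D := \prod_(p | p != (i, k)) _ => /introT D0'.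
have D0 : D != 0.
  apply: D0' => p pik; rewrite subr_eq0; apply: contraNneq pik => e.
  by rewrite eq_sym; apply/eqP; apply: inj.
move: D0; rewrite {D0'}/D.
rewrite (prod_punctured (fun j l => a i * q ^+ k - a j * q ^+ l))/=.
under eq_bigr do rewrite -mulrBl.
rewrite big_split/= prodr_const cardC1 card_ord.
pose g := (-1) ^+ k * a i ^- (n - k)%N * q ^ (triangular k - n%:Z * k%:Z).
(* g and h gather the extra factors of [numer_factor] and of [denom_factor];
   their powers of q match: triangular k + triangular (k - 1) = k ^ 2 *)
have [h gh den] : exists2 h, g * h = 1 & forall j,
    \prod_(l < n.+1 | l != k) (a i * q ^+ k - a j * q ^+ l) =
    h * a j ^+ k
    * (qpoch q (q * a i / a j) k * qpoch q (q * a j / a i) (n - k)%N).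
  eexists; last by move=> j; rewrite denom_factor.
  have qq : q ^ (triangular k - n%:Z * k%:Z)
      * q ^ (triangular (k%:Z - 1) + k%:Z * (n - k)%N%:Z) = 1.
    rewrite -expfzDr// [X in q ^ X](_ : _ = 0)//.
    have := triangularE k; have := triangularE (k%:Z - 1).
    have -> : (n - k)%N%:Z = n%:Z - k%:Z by lia.
    nia.
  have aa : a i ^- (n - k) * a i ^+ (n - k) = 1 by rewrite mulVf// expf_neq0.
  have ss : (-1) ^+ k * (-1) ^+ k = 1 :> K by rewrite -expr2 sqrr_sign.
  transitivity ((-1) ^+ k * (-1) ^+ k * (a i ^- (n - k) * a i ^+ (n - k))
    * (q ^ (triangular k - n%:Z * k%:Z)
      * q ^ (triangular (k%:Z - 1) + k%:Z * (n - k)%N%:Z))).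
    by rewrite /g; ring.
  by rewrite ss aa qq !mulr1.
under [\prod_(j < r.+1) \prod_(l < n.+1 | _) _]eq_bigr do rewrite den.
rewrite 3!big_split/= prodr_const card_ord.
rewrite horner_prod /numer_roots big_allpairs_dep/= big_enum/=.
pose N j := \prod_(s <- iota 0 (absz (n%:Z + m j)))
      ('X - (b j * q ^ (n%:Z - 1 - s%:Z))%:P).[a i * q ^+ k].
have num j : b j ^ m j * qpoch q (q * a i / b j) (m j)
    * qpoch q (q ^ (1 + m j) * a i / b j) k * qpoch q (b j / a i) (n - k)%N =
    (-1) ^ m j * q ^ triangular (m j) * (g * b j ^- k) * N j.
  rewrite numer_factor//; last exact: hm.
  rewrite -(big_mkord xpredT
    (fun s => a i * q ^+ k - b j * q ^ (n%:Z - 1 - s%:Z))).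
  by rewrite /N /index_iota subn0; under [in RHS]eq_bigr do rewrite hornerXsubC.
have : \prod_j (b j ^ m j * qpoch q (q * a i / b j) (m j)
    * qpoch q (q ^ (1 + m j) * a i / b j) k * qpoch q (b j / a i) (n - k)%N) =
    \prod_j ((-1) ^ m j * q ^ triangular (m j) * (g * b j ^- k) * N j).
  by apply: eq_bigr => j _; rewrite num.
rewrite 2!big_split/= [in RHS]big_split/= [in RHS]big_split/=.
rewrite [\prod_j (_ * _ j ^- k)]big_split/= [in RHS]big_split/=.
rewrite prodr_const card_ord prodfV !prodrXl.
rewrite !prod_exprz ?oppr_eq0 ?oner_eq0//.
rewrite /ccoef -/(triangular _).
rewrite -[\sum_j triangular _]/(mtotal2 m) -[\sum_j m _]/(mtotal m).
have -> : wparam q a b ^+ k = (q ^+ k ^+ r)^-1 * (\prod_j b j) ^+ k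
     / (\prod_j a j) ^+ k.
  by rewrite /wparam prodf_div exprMn exprVn -!exprM mulnC expr_div_n mulrA.
rewrite -[q ^ (- _)]invr_expz.
have -> : \prod_(j in 'I_r.+1) \prod_(s <- iota 0 (absz (n%:Z + m j)))
    ('X - (b j * q ^ (n%:Z - 1 - s%:Z))%:P).[a i * q ^+ k] = \prod_j N j.
  exact: eq_bigl.
have gh1 : g ^+ r.+1 * h ^+ r.+1 = 1 by rewrite -exprMn gh expr1n.
have sgn : (-1) ^ mtotal m * (-1) ^ mtotal m = 1 :> K.
  rewrite -expfzDr ?oppr_eq0 ?oner_eq0// -mulr2n -mulr_natl -exprz_exp.
  by rewrite -[_ ^ 2%:R]exprnP sqrrN expr1n exp1rz.
have Q0 : q ^ mtotal2 m != 0 by rewrite expfz_neq0.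
have pb0 : (\prod_j b j) ^+ k != 0 by rewrite expf_neq0//; apply/prodf_neq0.
move: gh1 sgn Q0 pb0.
set P := \prod_j (_ * _); set X1 := \prod_j qpoch q (q ^ _ * _ / _) k.
set X2 := \prod_j qpoch q (b j / a i) _; set NN := \prod_j N j.
set A := \prod_j qpoch q (q * a i / _) _.
set B := \prod_j qpoch q (q * _ / a i) _.
set d := \prod_(j < r.+1 | j != i) _; set qk := (q ^+ k) ^+ r; set hr := h ^+ _.
set gr := g ^+ _; set s := (-1) ^ _; set Q := q ^ _.
set pa := (\prod_j a j) ^+ k; set pb := (\prod_j b j) ^+ k.
move: P X1 X2 NN A B d qk hr gr s Q pa pb => P X1 X2 NN A B d qk hr gr s Q pa pb.
rewrite !mulf_eq0 !negb_or => gh1 ss Q0 pb0 key.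
move=> /andP[/andP[d0 qk0] /andP[/andP[hr0 pa0] /andP[A0 B0]]].
transitivity (P * X1 * X2 * (s / Q / d / qk * pb / pa / A / B)).
  by field; rewrite ?Q0 ?d0 ?qk0 ?pa0 ?A0 ?B0.
have grE : gr = hr^-1 by apply: (mulIf hr0); rewrite gh1 mulVf.
rewrite key grE; transitivity (s * s * (NN / (d * qk * (hr * pa * (A * B))))).
  by field; rewrite ?Q0 ?d0 ?qk0 ?pa0 ?A0 ?B0 ?hr0 ?pb0.
by rewrite ss mul1r.
Qed.

(** * The coefficients *)

Lemma size_numer_roots (K : fieldType) (q : K) (r : nat) (b : 'I_r.+1 -> K)
    (m : 'I_r.+1 -> int) (n : nat) : (forall j, 0 <= n%:Z + m j) ->
  (size (numer_roots q b m n))%:Z = n%:Z * r.+1%:Z + mtotal m.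
Proof.
move=> nm; rewrite /numer_roots size_allpairs_dep sumnE big_map big_enum/=.
rewrite (eq_bigr (fun j => absz (n%:Z + m j))); last first.
  by move=> j _; rewrite size_iota.
rewrite (big_morph Posz PoszD (erefl (0%N : int))).
under eq_bigr do rewrite gez0_abs//.
by rewrite big_split/= sumr_const card_ord -mulr_natr natz.
Qed.

Lemma poles_inj (K : fieldType) (q : K) (r : nat) (a : 'I_r.+1 -> K) (n : nat) :
    q != 0 -> (forall n, q ^+ n.+1 != 1) -> (forall i, a i != 0) ->
    (forall i j, i != j -> forall s : int, a i / a j != q ^ s) ->
  injective (fun p : 'I_r.+1 * 'I_n.+1 => a p.1 * q ^+ p.2).
Proof.
move=> q0 q1 a0 haa [i k] [j l]/= e.
have [eij|ij] := eqVneq i j; last first.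
  have /negP[] := haa i j ij (l%:Z - k%:Z); apply/eqP.
  rewrite expfzDr// -exprnN -exprnP.
  by apply/eqP; rewrite eqr_div// ?expf_neq0// e mulrC.
move: e; rewrite -eij => /(mulfI (a0 i)) e; congr pair; apply/val_inj => /=.
have qinj (s t : nat) : q ^+ s = q ^+ (s + t) -> t = 0%N.
  case: t => // t; rewrite exprD -[X in X = _]mulr1 => /(mulfI (expf_neq0 s q0)).
  by move=> e1; move: (q1 t); rewrite -e1 eqxx.
case: (leqP k l) => [/subnKC kl|/ltnW/subnKC kl].
  by move: e; rewrite -kl => /qinj ->; rewrite addn0.
by move: (esym e); rewrite -kl => /qinj ->; rewrite addn0.
Qed.

Lemma sum_poles (K : fieldType) (q : K) (r : nat) (a : 'I_r.+1 -> K) (n : nat) :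
  (1 - q) * \sum_(p : 'I_r.+1 * 'I_n.+1) a p.1 * q ^+ p.2 =
  (\sum_j a j) * (1 - q ^+ n.+1).
Proof.
rewrite -(pair_bigA _ (fun j (k : 'I_n.+1) => a j * q ^+ k))/=.
under eq_bigr do rewrite -mulr_sumr.
by rewrite -mulr_suml mulrCA -(opprB q) -(opprB (q ^+ _)) subrX1 mulNr.
Qed.

Lemma sum_numer_roots (K : fieldType) (q : K) (r : nat) (b : 'I_r.+1 -> K)
    (m : 'I_r.+1 -> int) (n : nat) : q != 0 ->
    (forall j, 0 <= n%:Z + m j) ->
  (1 - q) * \sum_(c <- numer_roots q b m n) c =
  \sum_j b j * q ^ (- m j) - (\sum_j b j) * q ^+ n.
Proof.
move=> q0 nm; rewrite /numer_roots big_allpairs_dep/= big_enum/=.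
rewrite mulr_suml mulr_sumr.
rewrite -sumrB; apply: eq_bigr => j _.
rewrite -mulr_sumr mulrCA -mulrBr; congr (_ * _).
have geo P : (1 - q) * \sum_(s <- iota 0 P) q ^ (n%:Z - 1 - s%:Z) =
    q ^ (n%:Z - P%:Z) - q ^+ n.
  elim: P => [|P IH]; first by rewrite big_nil mulr0 subr0 -exprnP subrr.
  rewrite -addn1 iotaD big_cat/= big_seq1 mulrDr {}IH add0n addn1.
  have -> : n%:Z - 1 - P%:Z = n%:Z - P.+1%:Z by lia.
  have -> : n%:Z - P%:Z = (n%:Z - P.+1%:Z) + 1 by lia.
  by rewrite expfzDr//; ring.
by rewrite geo; congr (q ^ _ - _); have := nm j; lia.
Qed.

(** Here deg N = n (r + 1) + M and deg D = (n + 1) (r + 1), so that the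
    hypothesis on M is what [sum_lagrange_roots] asks for. *)
Lemma Gcoef_value (K : fieldType) (q : K) (r : nat) (a b : 'I_r.+1 -> K)
    (m : 'I_r.+1 -> int) (n : nat) :
    q != 0 -> (forall n, q ^+ n.+1 != 1) -> (forall i, a i != 0) ->
    (forall i j, i != j -> forall s : int, a i / a j != q ^ s) ->
    (forall i, b i != 0) ->
    (forall j, m j < 0 -> forall (i : 'I_r.+1) (s : nat),
       s%:Z <= - m j - 1 -> a i / b j != q ^+ s) ->
    (forall j, 0 <= n%:Z + m j) -> mtotal m <= r%:Z + 1 ->
  Gcoef q a b m n =
  if mtotal m == r%:Z + 1 then
    (1 - q)^-1 * ((\sum_i a i - \sum_i b i * q ^ (- m i))
       - (q * (\sum_i a i) - \sum_i b i) * q ^+ n)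
  else (mtotal m == r%:Z)%:R.
Proof.
move=> q0 q1 a0 haa b0 hm nm Mr.
have inj := poles_inj q0 q1 a0 haa.
have -> : Gcoef q a b m n = \sum_(p : 'I_r.+1 * 'I_n.+1)
    (\prod_(c <- numer_roots q b m n) ('X - c%:P)).[a p.1 * q ^+ p.2]
    / \prod_(p' | p' != p) (a p.1 * q ^+ p.2 - a p'.1 * q ^+ p'.2).
  rewrite /Gcoef; under [LHS]eq_bigr => i _ do rewrite mulr_sumr.
  rewrite pair_bigA; apply: eq_bigr => -[i k] _ /=.
  by rewrite residue_term// => j mj s; apply: hm.
have szz := size_numer_roots q b nm.
have card : #|{: 'I_r.+1 * 'I_n.+1}| = (r.+1 * n.+1)%N.
  by rewrite card_prod !card_ord.
rewrite (sum_lagrange_roots (inj n)) card; [| nia | by []].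
have -> : (size (numer_roots q b m n) == r.+1 * n.+1)%N = (mtotal m == r%:Z + 1).
  by apply/eqP/eqP; nia.
have -> : ((size (numer_roots q b m n)).+1 == r.+1 * n.+1)%N = (mtotal m == r%:Z).
  by apply/eqP/eqP; nia.
case: ifP => // _.
have q10 : 1 - q != 0 by rewrite subr_eq0 eq_sym -[q]expr1 q1.
apply: (mulfI q10); rewrite mulVKf// mulrBr sum_poles sum_numer_roots//.
by rewrite exprS; ring.
Qed.

(** * Convergence of complex series *)

Local Open Scope classical_set_scope.

Lemma normc_le_ReIm (R : realType) (z : complexField R) :
  complex.Re `|z| <= `|complex.Re z| + `|complex.Im z|.
Proof.
case: z => x y; rewrite [`|_|]normc_def/=.
rewrite -[leRHS]ger0_norm ?addr_ge0// -sqrtr_sqr ler_wsqrtr//.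
rewrite sqrrD !real_normK ?num_real// -addrA lerD2l lerDr.
by rewrite mulrn_wge0// mulr_ge0.
Qed.

Lemma Re_le_norm (R : realType) (z : complexField R) :
  `|complex.Re z| <= complex.Re `|z|.
Proof. by have := normc_ge_Re z; rewrite lecE => /andP[]. Qed.

Lemma Im_le_norm (R : realType) (z : complexField R) :
  `|complex.Im z| <= complex.Re `|z|.
Proof.
case: z => x y; rewrite [X in _ <= complex.Re X]normc_def/=.
rewrite -sqrtr_sqr ler_wsqrtr//.
by rewrite lerDr sqr_ge0.
Qed.

Lemma Re_mono (R : realType) (x y : complexField R) : x <= y ->
  complex.Re x <= complex.Re y.
Proof. by rewrite [x <= y]lecE => /andP[]. Qed.

Lemma normRe (R : realType) (z : complexField R) :
  `|z| = (complex.Re `|z| +i* 0)%C :> complexField R.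
Proof. by case: z. Qed.

Lemma ReB (R : realType) (z w : complexField R) :
  complex.Re (z - w) = complex.Re z - complex.Re w.
Proof. by case: z; case: w. Qed.

Lemma ImB (R : realType) (z w : complexField R) :
  complex.Im (z - w) = complex.Im z - complex.Im w.
Proof. by case: z; case: w. Qed.

Lemma cvg_complex (R : realType) (s : nat -> complexField R) (x y : R) :
  complex.Re (s n) @[n --> \oo] --> x -> complex.Im (s n) @[n --> \oo] --> y ->
  s @ \oo --> (Complex x y : complexField R).
Proof.
move=> /cvgrPdist_lt hx /cvgrPdist_lt hy; apply/cvgrPdist_lt => e e0.
have [e' e'0 ee] : exists2 e' : R, 0 < e' & e = (e' +i* 0)%C.
  move: e0; case: e => e1 e2; rewrite [_ < _]ltcE/= => /andP[/eqP <- e10].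
  by exists e1.
have := hx (e' / 2); have := hy (e' / 2); rewrite divr_gt0//.
move=> /(_ isT) nx /(_ isT) ny; rewrite {}ee.
near=> n.
have := normc_le_ReIm ((x +i* y)%C - s n).
rewrite [`|(x +i* y)%C - s n|]normRe [_ < _]ltcE/= eqxx/=.
move=> /le_lt_trans; apply.
rewrite ReB ImB [ltRHS]splitr ltrD//=.
- near: n; exact: ny.
- near: n; exact: nx.
Unshelve. all: by end_near. Qed.

Lemma complex_nonneg (R : realType) (x : complexField R) : 0 <= x ->
  exists2 y : R, 0 <= y & x = (y +i* 0)%C.
Proof. by case: x => x y; rewrite [_ <= _]lecE/= => /andP[/eqP->]; exists x. Qed.

Lemma realcX (R : realType) (x : R) n :
  ((x +i* 0)%C : complexField R) ^+ n = (x ^+ n +i* 0)%C.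
Proof. by rewrite -[LHS]/((x%:C)%C ^+ n) -rmorphXn. Qed.

Lemma realcM (R : realType) (x y : R) :
  ((x +i* 0)%C : complexField R) * (y +i* 0)%C = (x * y +i* 0)%C.
Proof. by rewrite -[LHS]/((x%:C)%C * (y%:C)%C) -rmorphM. Qed.

Lemma cvg0_geo (R : realType) (s : nat -> complexField R) (C x : complexField R) :
  0 <= C -> 0 <= x < 1 -> (forall n, `|s n| <= C * x ^+ n) -> s @ \oo --> 0.
Proof.
move=> /complex_nonneg[c c0 ->] /andP[/complex_nonneg[y y0 ->]].
rewrite [_ < _]ltcE/= eqxx/= => y1 h.
have geo : (fun n => c * y ^+ n) @ \oo --> 0.
  by apply: cvg_geometric; rewrite ger0_norm.
have sq (f : complexField R -> R) : (forall z, `|f z| <= complex.Re `|z|) ->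
    f (s n) @[n --> \oo] --> 0.
  move=> fz; apply: norm_cvg0.
  apply: (@squeeze_cvgr _ _ _ _ (fun=> 0) (fun n => c * y ^+ n) _ _ 0 _ geo).
  - near=> n; rewrite normr_ge0/= (le_trans (fz _))//.
    by have /Re_mono := h n; rewrite realcX realcM.
  - exact: cvg_cst.
rewrite (_ : 0 = (0 +i* 0)%C)//.
by apply: cvg_complex; apply: sq => z; [exact: Re_le_norm|exact: Im_le_norm].
Unshelve. all: by end_near. Qed.

Lemma Re_series (R : realType) (u : nat -> complexField R) n :
  complex.Re (series u n) = series (fun k => complex.Re (u k)) n.
Proof.
elim: n => [|n IH]; first by rewrite /series/= !big_geq.
by rewrite !seriesSr -IH; case: (u n); case: (series u n).
Qed.

Lemma Im_series (R : realType) (u : nat -> complexField R) n :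
  complex.Im (series u n) = series (fun k => complex.Im (u k)) n.
Proof.
elim: n => [|n IH]; first by rewrite /series/= !big_geq.
by rewrite !seriesSr -IH; case: (u n); case: (series u n).
Qed.

(** Completeness comes from the reals, through the real and imaginary parts. *)
Lemma cvg_series_geo (R : realType) (u : nat -> complexField R)
    (C x : complexField R) :
  0 <= C -> 0 <= x < 1 -> (forall n, `|u n| <= C * x ^+ n) -> cvgn (series u).
Proof.
move=> /complex_nonneg[c c0 ->] /andP[/complex_nonneg[y y0 ->]].
rewrite [_ < _]ltcE/= eqxx/= => y1 h.
have sq (f : complexField R -> R) : (forall z, `|f z| <= complex.Re `|z|) ->
    cvgn (series (fun n => f (u n))).
  move=> fz; apply: normed_cvg.
  apply: (@series_le_cvg _ _ (fun n => c * y ^+ n)) => [n|n|n|].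
  - exact: normr_ge0.
  - by rewrite /= mulr_ge0// exprn_ge0.
  - rewrite (le_trans (fz _))//.
    by have /Re_mono := h n; rewrite realcX realcM.
  - by apply: is_cvg_geometric_series; rewrite ger0_norm.
have /cvg_ex[/= a ha] := sq _ (@Re_le_norm R).
have /cvg_ex[/= b hb] := sq _ (@Im_le_norm R).
apply: (cvgP ((a +i* b)%C : complexField R)); apply: cvg_complex.
- by under eq_fun do rewrite Re_series.
- by under eq_fun do rewrite Im_series.
Qed.

(** * Power series near 0 *)

Definition conv (K : pzRingType) (u v : nat -> K) (n : nat) : K :=
  \sum_(k < n.+1) u k * v (n - k)%N.

(** Summing by the first index instead of by the total degree. *)
Lemma series_conv (K : numFieldType) (u v : nat -> K) N :
  series (conv u v) N = \sum_(0 <= i < N) u i * series v (N - i)%N.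
Proof.
elim: N => [|N IH]; first by rewrite /series/= !big_geq.
rewrite seriesSr {}IH /conv [in RHS]big_nat_recr//= subSnn.
rewrite big_ord_recr/= subnn addrA.
rewrite -(big_mkord xpredT (fun k => u k * v (N - k)%N)).
rewrite -big_split/=; congr (_ + _ * _); last by rewrite /series/= big_nat1.
apply: eq_big_nat => i /andP[_ iN].
by rewrite subSn ?(ltnW iN)// seriesSr mulrDr.
Qed.

(** Partial sums of the Cauchy product differ from the product of the partial
    sums by the terms u_i v_j with i, j < N <= i + j.  There are at most N^2 of
    them, each of size O(8^-N), and N^2 <= 4^N, so the difference is O(2^-N).
    The ratio 1/8 costs nothing, since the product is only needed near 0. *)
Lemma cvg_conv (R : realType) (u v : nat -> complexField R)
    (C D U V : complexField R) :
    0 <= C -> 0 <= D ->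
    (forall n, `|u n| <= C * 8^-1 ^+ n) -> (forall n, `|v n| <= D * 8^-1 ^+ n) ->
    series u @ \oo --> U -> series v @ \oo --> V ->
  series (conv u v) @ \oo --> U * V.
Proof.
move=> C0 D0 hu hv cu cv.
pose d N := series u N * series v N - series (conv u v) N.
suff d0 : d @ \oo --> (0 : complexField R).
  have -> : series (conv u v) = (series u \* series v) \- d.
    by apply/funext => N /=; rewrite opprB addrC subrK.
  rewrite -[U * V]subr0.
  apply: (@cvgB (complexField R) (complexField R)) d0.
  exact: (@cvgM (complexField R)) cu cv.
have e80 n : 0 <= 8^-1 ^+ n :> complexField R by rewrite exprn_ge0// invr_ge0.
apply: (@cvg0_geo _ _ (C * D) 2^-1) => [||N].
- by rewrite mulr_ge0.
- by rewrite invr_ge0 ler0n/= invf_lt1// ltr1n.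
have -> : d N =
    \sum_(0 <= i < N) u i * \sum_(N - i <= j < N) v j.
  rewrite /d series_conv /series/= mulr_suml -sumrB; apply: eq_big_nat => i iN.
  rewrite -mulrBr (big_cat_nat (n := (N - i)%N))//= ?leq_subr//.
  by rewrite [X in _ * (X - _)]addrC addrK.
apply: (le_trans (ler_norm_sum _ _ _)).
apply: (@le_trans _ _ (\sum_(0 <= i < N) (C * D * 8^-1 ^+ N * N%:R))).
  apply: ler_sum_nat => i /andP[_ iN]; rewrite normrM.
  apply: (@le_trans _ _ (C * 8^-1 ^+ i * (D * 8^-1 ^+ (N - i) * N%:R))).
    apply: ler_pM => //.
    apply: (le_trans (ler_norm_sum _ _ _)).
    apply: (@le_trans _ _ (\sum_(N - i <= j < N) (D * 8^-1 ^+ (N - i)))).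
      apply: ler_sum_nat => j /andP[jN _]; apply: (le_trans (hv j)).
      by rewrite ler_wpM2l// ler_wiXn2l// ?invr_ge0// invf_le1// ler1n.
    rewrite sumr_const_nat -[leLHS]mulr_natr ler_wpM2l ?mulr_ge0// ler_nat.
    by rewrite leq_subLR leq_addl.
  rewrite -[X in _ <= _ * _ ^+ X * _](subnKC (ltnW iN)) exprD.
  by rewrite !mulrA [C * _ * D]mulrAC.
rewrite sumr_const_nat subn0 -[leLHS]mulr_natr -!mulrA !ler_wpM2l//.
rewrite -natrM.
have -> : 2^-1 = 8^-1 * 4 :> complexField R by field.
rewrite [leRHS]exprMn ler_wpM2l// -natrX ler_nat.
by rewrite -[4%N]/(2 ^ 2)%N -expnM mulnC expnM -mulnn leq_mul// ltnW// ltn_expl.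
Qed.

Definition geo_bounded (K : numDomainType) (u : nat -> K) : Prop :=
  exists C B : K, [/\ 0 <= C, 0 < B & forall n, `|u n| <= C * B ^+ n].

Definition power_sum (K : numFieldType) (u : nat -> K) (F : K -> K) : Prop :=
  \forall z \near (0 : K), series (fun n => u n * z ^+ n) @ \oo --> F z.

(** The radius 1 / (8 B) is where B |z| drops below the ratio 1/8 that
    [cvg_conv] asks for. *)
Lemma geo_bounded_near0 (K : numFieldType) (u : nat -> K) : geo_bounded u ->
  exists2 C, 0 <= C & \forall z \near (0 : K),
    forall n, `|u n * z ^+ n| <= C * 8^-1 ^+ n.
Proof.
move=> [C [B [C0 B0 hu]]]; exists C => //.
have e0 : 0 < (8 * B)^-1 by rewrite invr_gt0 mulr_gt0.
near=> z => n; rewrite normrM normrX.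
apply: (@le_trans _ _ (C * B ^+ n * `|z| ^+ n)).
  by rewrite ler_wpM2r// exprn_ge0.
rewrite -mulrA -exprMn ler_wpM2l// lerXn2r ?nnegrE ?mulr_ge0 ?invr_ge0 ?(ltW B0)//.
have zb : `|z| <= (8 * B)^-1.
  by near: z; apply: (@pseudometric_normed_Zmodule.nbhs0_le K K).
apply: (le_trans (ler_wpM2l (ltW B0) zb)).
by rewrite invfM mulrCA divff ?mulr1// gt_eqF.
Unshelve. all: by end_near. Qed.

Lemma power_sum_limn (R : realType) (u : nat -> complexField R) :
  geo_bounded u ->
  power_sum u (fun z => limn (series (fun n => u n * z ^+ n))).
Proof.
move=> /geo_bounded_near0[C C0 hu]; near=> z.
apply: (@cvg_series_geo _ _ C 8^-1) => //.
  by rewrite invr_ge0 ler0n/= invf_lt1// ltr1n.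
near: z; exact hu.
Unshelve. all: by end_near. Qed.

Lemma power_sumM (R : realType) (u v : nat -> complexField R) F G :
  geo_bounded u -> geo_bounded v -> power_sum u F -> power_sum v G ->
  power_sum (conv u v) (fun z => F z * G z).
Proof.
move=> /geo_bounded_near0[C C0 hu] /geo_bounded_near0[D D0 hv] uF vG.
rewrite /power_sum.
apply: filterS (filterI (filterI hu hv) (filterI uF vG)) => z [[hz vz] [Fz Gz]].
have -> : (fun n => conv u v n * z ^+ n) =
    conv (fun n => u n * z ^+ n) (fun n => v n * z ^+ n).
  apply/funext => n; rewrite /conv mulr_suml; apply: eq_bigr => k _.
  have kn : (k <= n)%N by rewrite -ltnS.
  by rewrite [RHS]mulrACA -exprD subnKC.
exact: (cvg_conv C0 D0 hz vz Fz Gz).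
Qed.

Lemma power_sumZ (R : realType) c (u : nat -> complexField R) F :
  power_sum u F -> power_sum (fun n => c * u n) (fun z => c * F z).
Proof.
rewrite /power_sum; apply: filterS => z Fz.
have -> : series (fun n => c * u n * z ^+ n) =
    (fun N => c * series (fun n => u n * z ^+ n) N).
  apply/funext => N; rewrite /series/= mulr_sumr.
  by apply: eq_bigr => n _; rewrite mulrA.
exact: (@cvgMl_tmp (complexField R)) Fz.
Qed.

Lemma power_sumD (R : realType) (u v : nat -> complexField R) F G :
  power_sum u F -> power_sum v G ->
  power_sum (fun n => u n + v n) (fun z => F z + G z).
Proof.
move=> uF vG; apply: filterS (filterI uF vG) => z [Fz Gz].
have -> : series (fun n => (u n + v n) * z ^+ n) =
    (series (fun n => u n * z ^+ n) \+ series (fun n => v n * z ^+ n)).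
  apply/funext => N; rewrite /series/= -big_split/=.
  by apply: eq_bigr => n _; rewrite mulrDl.
exact: (@cvgD (complexField R) (complexField R)) Fz Gz.
Qed.

Lemma power_sum0 (K : numFieldType) : power_sum (fun=> 0 : K) (fun=> 0).
Proof.
near=> z.
rewrite (_ : series _ = (fun=> 0)); first exact: cvg_cst.
by apply/funext => N; rewrite /series/= big1// => n _; rewrite mul0r.
Unshelve. all: by end_near. Qed.

Lemma power_sum_sum (R : realType) (I : Type) (s : seq I)
    (u : I -> nat -> complexField R) F :
  (forall i, power_sum (u i) (F i)) ->
  power_sum (fun n => \sum_(i <- s) u i n) (fun z => \sum_(i <- s) F i z).
Proof.
move=> uF; elim: s => [|i s IH].
  under eq_fun do rewrite big_nil.
  by under [X in power_sum _ X]eq_fun do rewrite big_nil; exact: power_sum0.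
under eq_fun do rewrite big_cons.
under [X in power_sum _ X]eq_fun do rewrite big_cons.
exact (power_sumD (uF i) IH).
Qed.

Lemma power_sum_geo (R : realType) (c : complexField R) :
  power_sum (fun n => c ^+ n) (fun z => 1 / (1 - c * z)).
Proof.
have [C C0 hc] : exists2 C : complexField R, 0 <= C &
    \forall z \near (0 : complexField R),
    forall n, `|c ^+ n * z ^+ n| <= C * 8^-1 ^+ n.
  apply: geo_bounded_near0; exists 1, (`|c| + 1); split=> // n.
  by rewrite normrX mul1r lerXn2r ?nnegrE ?addr_ge0// lerDl.
near=> z.
have cz : (fun n => c ^+ n * z ^+ n) @ \oo --> (0 : complexField R).
  apply: (@cvg0_geo _ _ C 8^-1) => //.
    by rewrite invr_ge0 ler0n/= invf_lt1// ltr1n.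
  by near: z; exact hc.
have {}cz : (fun n => (c * z) ^+ n) @ \oo --> (0 : complexField R).
  by under eq_fun do rewrite exprMn.
have cz1 : 1 - c * z != 0.
  apply/negP => /eqP/subr0_eq czE; move: cz; rewrite -czE.
  under eq_fun do rewrite expr1n.
  move=> /(cvg_lim (@norm_hausdorff _ _)).
  rewrite lim_cst; last exact: norm_hausdorff.
  by move/eqP; rewrite oner_eq0.
have -> : series (fun n => c ^+ n * z ^+ n) =
    (fun N => (1 - (c * z) ^+ N) / (1 - c * z)).
  apply/funext => N; apply: (mulIf cz1); rewrite divfK//.
  rewrite -[RHS]opprB subrX1 -[RHS]mulNr opprB mulrC; congr (_ * _).
  by rewrite /series/= big_mkord; apply: eq_bigr => n _; rewrite exprMn.
apply: (@cvgMr_tmp (complexField R)).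
rewrite -[X in _ --> X](subr0 (1 : complexField R)).
apply: (@cvgB (complexField R) (complexField R)) cz; exact: cvg_cst.
Unshelve. all: by end_near. Qed.

Lemma power_sum_affine_geo (R : realType) (q c d : complexField R) :
  power_sum (fun n => c + d * q ^+ n) (fun z => c / (1 - z) + d / (1 - q * z)).
Proof.
have := power_sumD (power_sumZ c (power_sum_geo (1 : complexField R)))
  (power_sumZ d (power_sum_geo q)).
under eq_fun do rewrite expr1n mulr1.
by under [X in power_sum _ X]eq_fun do rewrite !mul1r.
Qed.

Lemma power_sum_eq_mod (R : realType) (u v : nat -> complexField R) F G d :
  power_sum u F -> power_sum v G -> (forall n, (d <= n)%N -> u n = v n) ->
  eq_near0 (fun z => F z - G z) (fun z => (\poly_(n < d) (u n - v n)).[z]).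
Proof.
move=> uF vG uv.
have := power_sumD uF (power_sumZ (-1) vG).
rewrite /power_sum /eq_near0; apply: filterS => z Fz.
have FG : F z + -1 * G z = F z - G z by rewrite mulN1r.
rewrite FG in Fz; apply: (cvg_unique (@norm_hausdorff _ (complexField R)) Fz).
apply: cvg_near_cst; near=> N.
have dN : (d <= N)%N by near: N; exists d.
rewrite horner_poly /series/= (big_cat_nat (n := d))//=.
rewrite [X in _ + X]big_nat_cond [X in _ + X]big1 ?addr0 => [|n]; last first.
  by rewrite andbT => /andP[/uv-> _]; rewrite mulN1r subrr mul0r.
by rewrite big_mkord; apply: eq_bigr => n _; rewrite mulN1r.
Unshelve. all: by end_near. Qed.

Lemma power_sum_eq (R : realType) (u v : nat -> complexField R) F G :
  power_sum u F -> power_sum v G -> (forall n, u n = v n) -> eq_near0 F G.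
Proof.
move=> uF vG uv; have := power_sum_eq_mod uF vG (fun n (_ : (0 <= n)%N) => uv n).
rewrite /eq_near0; apply: filterS => z.
by rewrite horner_poly big_ord0 => /subr0_eq.
Qed.

(** * Growth of hypergeometric coefficients *)

Lemma geo_boundedM (K : numDomainType) (u v : nat -> K) :
  geo_bounded u -> geo_bounded v -> geo_bounded (fun k => u k * v k).
Proof.
move=> [C [B [C0 B0 hu]]] [D [E [D0 E0 hv]]]; exists (C * D), (B * E).
split=> [||n]; [exact: mulr_ge0 | exact: mulr_gt0 |].
by rewrite normrM exprMn mulrACA ler_pM.
Qed.

Lemma geo_bounded_bigprod (K : numDomainType) (I : Type) (s : seq I)
    (u : I -> nat -> K) : (forall i, geo_bounded (u i)) ->
  geo_bounded (fun k => \prod_(i <- s) u i k).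
Proof.
move=> hu; elim: s => [|i s IH].
  exists 1, 1; split=> // n; by rewrite big_nil expr1n mulr1 normr1.
by under eq_fun do rewrite big_cons; exact: geo_boundedM.
Qed.

Lemma geo_bounded_prod (K : numDomainType) (B : K) (f : nat -> K) : 0 < B ->
  (forall s, `|f s| <= B) -> geo_bounded (fun k => \prod_(0 <= s < k) f s).
Proof.
move=> B0 hf; exists 1, B; split=> // n; rewrite mul1r.
elim: n => [|n IH]; first by rewrite big_geq// normr1.
by rewrite big_nat_recr//= normrM exprSr ler_pM.
Qed.

Lemma geo_boundedX (K : numDomainType) (c : K) : geo_bounded (fun k => c ^+ k).
Proof.
exists 1, (`|c| + 1); split=> // n.
by rewrite normrX mul1r lerXn2r ?nnegrE ?addr_ge0// lerDl.
Qed.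

Lemma geo_bounded_qpoch (K : numFieldType) (q x : K) : `|q| <= 1 ->
  geo_bounded (fun k => qpoch q x k).
Proof.
move=> q1; apply: (@geo_bounded_prod _ (1 + `|x|)) => [|s].
  by rewrite ltr_wpDr.
apply: (le_trans (ler_normB _ _)); rewrite normr1 lerD2l normrM normrX.
by rewrite ler_piMr// exprn_ile1.
Qed.

(** The factors 1 - x q^s tend to 1 without vanishing, so their inverses form a
    convergent, hence bounded, sequence. *)
Lemma geo_bounded_qpochV (R : realType) (q x : complexField R) : `|q| < 1 ->
  (forall s, x * q ^+ s != 1) -> geo_bounded (fun k => (qpoch q x k)^-1).
Proof.
move=> q1 xq.
have cq : (fun s => x * q ^+ s) @ \oo --> (0 : complexField R).
  apply: (@cvg0_geo _ _ `|x| `|q|) => //; first by rewrite normr_ge0.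
  by move=> n; rewrite normrM normrX.
have c1 : (fun s => (1 - x * q ^+ s)^-1) @ \oo --> ((1 - 0)^-1 : complexField R).
  apply: (@cvgV (complexField R)); first by rewrite subr0 oner_eq0.
  by apply: (@cvgB (complexField R) (complexField R)) cq; exact: cvg_cst.
have [M [Mr hM]] := cvg_seq_bounded (cvgP _ c1).
under eq_fun do rewrite /qpoch -prodfV.
apply: (@geo_bounded_prod _ (`|M| + 1)) => [|s]; first by rewrite ltr_wpDl.
apply: hM => //; apply: (le_lt_trans (real_ler_norm Mr)).
by rewrite ltrDl.
Qed.

Lemma geo_bounded_qhyp_coef (R : realType) (q : complexField R) (r : nat)
    (b : 'I_r.+1 -> complexField R) (a : 'I_r -> complexField R) :
  `|q| < 1 -> (forall j s, a j * q ^+ s != 1) -> (forall n, q ^+ n.+1 != 1) ->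
  geo_bounded (qhyp_coef q b a).
Proof.
move=> q1 ha hq; rewrite /qhyp_coef.
under eq_fun do rewrite -prodfV.
apply: geo_boundedM; first apply: geo_boundedM.
- by apply: geo_bounded_bigprod => j; apply: geo_bounded_qpoch; exact: ltW.
- by apply: geo_bounded_bigprod => j; apply: geo_bounded_qpochV.
- by apply: geo_bounded_qpochV => // s; rewrite -exprS.
Qed.

(** * The theorem *)

(** Absorbs the dilation by w, so that both series are power series in z. *)
Lemma qhypE (K : numClosedFieldType) (q : K) (r : nat) (b : 'I_r.+1 -> K)
    (a : 'I_r -> K) (w z : K) :
  qhyp q b a (w * z) =
  limn (series (fun k => w ^+ k * qhyp_coef q b a k * z ^+ k)).
Proof.
rewrite /qhyp; congr (limn (series _)); apply/funext => k.
by rewrite /qhyp_coef exprMn; ring.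
Qed.

Lemma power_sum_Gfun (R : realType) (r : nat) (q : complexField R)
    (a b : 'I_r.+1 -> complexField R) (m : 'I_r.+1 -> int) :
    0 < `|q| < 1 -> (forall n, q ^+ n.+1 != 1) ->
    (forall i j, i != j -> forall s : int, a i / a j != q ^ s) ->
  power_sum (Gcoef q a b m) (Gfun q a b m).
Proof.
move=> /andP[q0 q1] qn haa.
have q0' : q != 0 by rewrite -normr_gt0.
have low i j s : q * a i / a (lift i j) * q ^+ s != 1.
  have /(_ (- s.+1%:Z)) h := haa i (lift i j) (neq_lift i j).
  apply: contraNneq h => e; rewrite -exprnN; apply/eqP.
  apply: (mulIf (expf_neq0 s.+1 q0')).
  by rewrite mulVf ?expf_neq0// -e exprS; ring.
have low' i j s : q * a (lift i j) / a i * q ^+ s != 1.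
  have ij : lift i j != i by rewrite eq_sym neq_lift.
  have /(_ (- s.+1%:Z)) h := haa (lift i j) i ij.
  apply: contraNneq h => e; rewrite -exprnN; apply/eqP.
  apply: (mulIf (expf_neq0 s.+1 q0')).
  by rewrite mulVf ?expf_neq0// -e exprS; ring.
have bnd i : geo_bounded (qhyp_coef q (fun j => q ^ (1 + m j) * a i / b j)
    (fun j => q * a i / a (lift i j))).
  by apply: geo_bounded_qhyp_coef => // j s; exact: low.
have bnd' i : geo_bounded (qhyp_coef q (fun j => b j / a i)
    (fun j => q * a (lift i j) / a i)).
  by apply: geo_bounded_qhyp_coef => // j s; exact: low'.
have PS b' d' c : geo_bounded (qhyp_coef q (r := r) b' d') ->
    geo_bounded (fun k => c ^+ k * qhyp_coef q b' d' k) /\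
    power_sum (fun k => c ^+ k * qhyp_coef q b' d' k)
              (fun z => qhyp q b' d' (c * z)).
  move=> h; have h' := geo_boundedM (geo_boundedX c) h; split=> //.
  have := power_sum_limn h'.
  by under [X in power_sum _ X -> _]eq_fun => z do rewrite -qhypE.
apply: power_sum_sum => i.
have [g1 p1] := PS _ _ (wparam q a b) (bnd i).
have [g2 p2] := PS _ _ 1 (bnd' i).
have := power_sumZ (ccoef q a b m i) (power_sumM g1 g2 p1 p2).
under [X in power_sum _ X -> _]eq_fun => z do rewrite mulrA mul1r.
rewrite (_ : (fun k => 1 ^+ k * _ k) = qhyp_coef q (fun j => b j / a i)
    (fun j => q * a (lift i j) / a i)) //.
by apply/funext => k; rewrite expr1n mul1r.
Qed.

Local Close Scope classical_set_scope.

Theorem theorem2 (R : realType) (r : nat) (q : complexField R)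
    (a b : 'I_r.+1 -> complexField R) (m : 'I_r.+1 -> int)
    (hq : 0 < `|q| < 1)
    (ha : forall i, a i != 0)
    (haa : forall i j : 'I_r.+1, (i < j)%N ->
             forall n : int, a i / a j != q ^ n)
    (hb : forall i, b i != 0)
    (hm : forall j, m j < 0 ->
            forall (i : 'I_r.+1) (s : nat), s%:Z <= - m j - 1 ->
              a i / b j != q ^+ s) :
  ((forall i, 0 <= m i) ->
     [/\ mtotal m < r%:Z -> eq_near0 (Gfun q a b m) (fun=> 0),
         mtotal m = r%:Z -> eq_near0 (Gfun q a b m) (fun z => 1 / (1 - z))
       & mtotal m = r%:Z + 1 -> eq_near0 (Gfun q a b m) (rhs_iii q a b m)])
  /\
  ((exists i, m i < 0) ->
     [/\ mtotal m < r%:Z ->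
           eq_near0_mod `|mleast m|%N (Gfun q a b m) (fun=> 0),
         mtotal m = r%:Z ->
           eq_near0_mod `|mleast m|%N (Gfun q a b m) (fun z => 1 / (1 - z))
       & mtotal m = r%:Z + 1 ->
           eq_near0_mod `|mleast m|%N (Gfun q a b m) (rhs_iii q a b m)]).

Proof.
have /andP[q0' q1] := hq.
have q0 : q != 0 by rewrite -normr_gt0.
have qn n : q ^+ n.+1 != 1.
  apply/eqP => /(congr1 Num.norm); rewrite normrX normr1 => /eqP.
  by rewrite lt_eqF// exprn_ilt1.
have haa' i j : i != j -> forall s : int, a i / a j != q ^ s.
  rewrite -(inj_eq val_inj) neq_ltn => /orP[ij s|ji s]; first exact: haa.
  have := haa j i ji (- s); apply: contraNneq => e.
  by rewrite -invf_div e invr_expz.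
have GG := power_sum_Gfun (a := a) b m hq qn haa'.
have ml j : mleast m <= m j by exact: bigmin_le.
(* the coefficients of the right-hand sides *)
pose t n : complexField R := if mtotal m == r%:Z + 1 then
    (1 - q)^-1 * ((\sum_i a i - \sum_i b i * q ^ (- m i))
       - (q * (\sum_i a i) - \sum_i b i) * q ^+ n)
  else (mtotal m == r%:Z)%:R.
have Gt d : (forall j, 0 <= d%:Z + m j) -> mtotal m <= r%:Z + 1 ->
    forall n, (d <= n)%N -> Gcoef q a b m n = t n.
  move=> hd hM n dn; apply: Gcoef_value => // j.
  by have := hd j; lia.
have t1 : mtotal m < r%:Z -> power_sum t (fun=> 0).
  move=> Mr; rewrite (_ : t = (fun=> 0)); first exact (power_sum0 _).
  by apply/funext => n; rewrite /t !lt_eqF// ltr_wpDr.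
have t2 : mtotal m = r%:Z -> power_sum t (fun z => 1 / (1 - z)).
  move=> Mr; have := power_sum_geo (1 : complexField R).
  rewrite (_ : t = (fun n => 1 ^+ n)).
    by under [X in power_sum _ X -> _]eq_fun => z do rewrite [1 * z]mul1r.
  apply/funext => n; rewrite /t Mr eqxx expr1n.
  by case: eqP => //; lia.
have t3 : mtotal m = r%:Z + 1 -> power_sum t (rhs_iii q a b m).
  move=> Mr; rewrite /rhs_iii /=.
  set al := \sum_i a i; set be := \sum_i b i; set C := al - _.
  have := power_sumZ (1 - q)^-1 (power_sum_affine_geo q C (- (q * al - be))).
  rewrite (_ : t = fun n => (1 - q)^-1 * (C + - (q * al - be) * q ^+ n)).
    by under [X in power_sum _ X -> _]eq_fun do rewrite mulNr.
  by apply/funext => n; rewrite /t Mr eqxx mulNr.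
split=> [m0|[i0 mi0]].
- have G0 := Gt 0%N (fun j => ltac:(rewrite add0r; exact: m0)).
  have main T : mtotal m <= r%:Z + 1 -> power_sum t T ->
      eq_near0 (Gfun q a b m) T.
    move=> Mr tT.
    exact (power_sum_eq GG tT (fun n => G0 Mr n isT)).
  split=> Mr.
  + by refine (main _ _ (t1 Mr)); rewrite ltW// (lt_trans Mr)// ltrDl.
  + by refine (main _ _ (t2 Mr)); rewrite Mr lerDl.
  + by refine (main _ _ (t3 Mr)); rewrite Mr.
- have G0 := Gt `|mleast m|%N (fun j => ltac:(have := ml j; lia)).
  have main T : mtotal m <= r%:Z + 1 -> power_sum t T ->
      eq_near0_mod `|mleast m|%N (Gfun q a b m) T.
    move=> Mr tT; exists (\poly_(n < `|mleast m|%N) (Gcoef q a b m n - t n)).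
      by rewrite (leq_trans (size_poly _ _)).
    exact (power_sum_eq_mod GG tT (G0 Mr)).
  split=> Mr.
  + by refine (main _ _ (t1 Mr)); rewrite ltW// (lt_trans Mr)// ltrDl.
  + by refine (main _ _ (t2 Mr)); rewrite Mr lerDl.
  + by refine (main _ _ (t3 Mr)); rewrite Mr.
Qed.
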